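(* Let $Y$ be the number of isolated vertices in the Erdős–Rényi random graph $\mathcal{G}\sim\mathrm{ER}(n,m)$ on $n$ vertices having exactly $m$ edges, distributed uniformly at random. Let $\mu_{n,m}$ and $\sigma_{n,m}^2$ be the mean and variance of $Y$, let $W=(Y-\mu_{n,m})/\sigma_{n,m}$ when $\sigma_{n,m}>0$ and $W=0$ otherwise, and let $$\Theta=\Big\{(n,m): n\ge 3,\ 0<m<\tbinom n2\Big\}.$$ Then there exists a universal constant $C>0$ such that, for all $(n,m)\in\Theta$, $$\sup_{z\in\mathbb{R}}\big|\mathbb{P}_{n,m}[W\le z]-\Phi(z)\big|\le\frac{C}{r_{n,m}},\qquad\text{where}\quad r_{n,m}=\frac{\sigma_{n,m}^3}{\mu_{n,m}\big(1+\frac{m^2}{n^2}\big)} .$$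
   Context: $n,m$ are integers. $\mathrm{ER}(n,m)$ is the uniform distribution over all simple graphs on vertex set $\{1,\dots,n\}$ with exactly $m$ edges; $\mathbb{P}_{n,m}$ is the corresponding probability. A vertex is isolated if it has degree $0$. $\Phi$ is the standard normal distribution function. Convention: $r_{n,m}=0$ when $\sigma_{n,m}=0$, and $C/0=+\infty$, so the bound is vacuous in that case. *)

(* Defs.v *)
From HB Require Import structures.
From mathcomp Require Import all_boot all_order all_algebra.
From mathcomp Require Import all_classical all_reals all_analysis.

Set Implicit Arguments.
Unset Strict Implicit.
Unset Printing Implicit Defensive.

Import Order.TTheory GRing.Theory Num.Theory.

Local Open Scope ring_scope.

(* A graph on n labelled vertices is its edge set; the vertices 1, ..., n are
   represented by 'I_n = {0, ..., n - 1}. It is simple when every edge is an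
   unordered pair of distinct vertices. *)
Definition graph (n : nat) := {set {set 'I_n}}.

Definition simple_graph n (G : graph n) : bool := [forall e in G, #|e| == 2].

Definition degree n (G : graph n) (v : 'I_n) : nat := #|[set e in G | v \in e]|.

Definition isolated n (G : graph n) (v : 'I_n) : bool := degree G v == 0.

Definition nb_isolated n (G : graph n) : nat := #|[set v | isolated G v]|.

Definition ER_support (n m : nat) : {set graph n} :=
  [set G : graph n | simple_graph G & #|G| == m].

(* Since graph n also contains non-simple edge sets, ER(n,m) is given by its
   mass function, which vanishes off its support. *)
Definition ER (R : realType) (n m : nat) (G : graph n) : R :=
  if G \in ER_support n m then #|ER_support n m|%:R^-1 else 0.

Definition ER_prob (R : realType) (n m : nat) (A : pred (graph n)) : R :=
  \sum_(G : graph n | A G) ER R m G.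

Definition ER_expect (R : realType) (n m : nat) (X : graph n -> R) : R :=
  \sum_(G : graph n) ER R m G * X G.

Definition ER_variance (R : realType) (n m : nat) (X : graph n -> R) : R :=
  ER_expect m (fun G => (X G - ER_expect m X) ^+ 2).

Definition Y (R : realType) (n : nat) (G : graph n) : R := (nb_isolated G)%:R.

Definition mu (R : realType) (n m : nat) : R := ER_expect m (@Y R n).

Definition sigma (R : realType) (n m : nat) : R :=
  Num.sqrt (ER_variance m (@Y R n)).

Definition W (R : realType) (n m : nat) (G : graph n) : R :=
  if 0 < sigma R n m then (Y R G - mu R n m) / sigma R n m else 0.

Definition Phi (R : realType) (z : R) : R :=
  fine (normal_prob (0 : R) 1 [set x : R | x <= z]%classic).

Definition r (R : realType) (n m : nat) : R :=
  if sigma R n m == 0 then 0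
  else sigma R n m ^+ 3 / (mu R n m * (1 + m%:R ^+ 2 / n%:R ^+ 2)).

Definition Theta (n m : nat) : bool := (3 <= n)%N && (0 < m < 'C(n, 2))%N.

(* Main.v *)
Require Import Defs.
From HB Require Import structures.
From mathcomp Require Import all_boot all_order all_algebra.
From mathcomp Require Import all_classical all_reals all_analysis.
From mathcomp Require Import complex ring lra.
Import Order.TTheory GRing.Theory Num.Theory.
Local Open Scope ring_scope.

Set Implicit Arguments.
Unset Strict Implicit.
Unset Printing Implicit Defensive.

(** The number [Y] of isolated vertices has the law of a sum of independent
    Bernoulli variables. For such sums the distance to the normal law is at most
    [C / sigma], and the variance is at most the mean; hence
    [r = sigma^3 / (mu * (1 + m^2 / n^2)) <= sigma], and the bound [C / r] follows.

    The law of [Y]. By inclusion-exclusion the graphs with [m] edges are counted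
    according to their isolated vertices by the polynomial [H_m (X - 1)], where
    [H_m = sum_k 'C(n, k) * 'C('C(n - k, 2), m) * X^k] ([isolated_polyE]). Here
    [H_0 = (1 + X)^n], and [H_(m+1)] comes from [H_m] by multiplying the [k]-th
    coefficient by a quadratic polynomial in [k] with real roots, that is, by
    applying two operators [g - X d/dX] ([moment_polyS]). Such an operator
    creates no nonreal zero when the coefficients are nonnegative
    ([real_stable_euler_op]). So [H_m (X - 1)] has only real zeros; as its
    coefficients are counts, they are nonpositive, and the polynomial is
    proportional to a product of factors [(1 - a) + a X] with [0 <= a <= 1]
    ([real_stable_bernoulli]).

    The normal approximation is Stein's method. For a sum of independent
    Bernoulli variables standardised to [W], with [d = 1 / sigma], the identity
    for [E (W f(W))] involves only difference quotients of [f] over steps of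
    length [d] that start or end at a value of [W] ([stein_identity], [sd_var]).
    Thus [E (f'(W) - W f(W))] compares derivatives with difference quotients, and
    for the solution [f] of Stein's equation at [z] they differ by [O(d)], except
    within [d] of [z], where [f'] jumps ([stein_sol_diff]). The same identity,
    used with a truncated linear function, shows that [W] lies within [d] of [z]
    with probability at most [2 d] ([concentration]). *)

(** * Polynomials with only real zeros *)

Section RealStable.
Variable R : rcfType.
Implicit Types (p q : {poly R}) (z : R[i]).

Local Notation Re := complex.Re.
Local Notation Im := complex.Im.

Definition toC : {poly R} -> {poly R[i]} := map_poly (real_complex R).

(** A real polynomial has only real zeros; phrased as non-vanishing off the real
    axis because that form survives multiplication by a nonzero function. *)
Definition real_stable p := forall z, Im z != 0 -> ~~ root (toC p) z.

Definition nonneg_coefs p := forall i, 0 <= p`_i.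

Lemma real_stable_neq0 p : real_stable p -> p != 0.
Proof.
move=> /(_ (Complex 0 1)) /=; rewrite oner_neq0 => /(_ isT).
by apply: contraNneq => ->; rewrite /toC rmorph0 root0.
Qed.

(** The linear factors over the closed field [R[i]] have real roots, so the
    factorisation descends along the embedding of [R]. *)
Lemma real_stable_split p : real_stable p ->
  exists s : seq R, p = lead_coef p *: \prod_(a <- s) ('X - a%:P).
Proof.
move=> st; have [s Es] := closed_field_poly_normal (toC p).
have p0 := real_stable_neq0 st.
have lp0 : lead_coef (toC p) != 0 by rewrite lead_coef_eq0 map_poly_eq0.
have real_s z : z \in s -> (Re z)%:C%C = z.
  move=> zs; have : root (toC p) z by rewrite Es rootZ ?root_prod_XsubC.
  case: (eqVneq (Im z) 0) => [|/st/negPf->//].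
  by case: z zs => a b /= _ ->.
exists [seq Re z | z <- s]; apply: (@map_poly_inj _ _ (real_complex R)).
rewrite -/(toC p) Es map_polyZ /= lead_coef_map /=; congr (_ *: _).
rewrite rmorph_prod big_map big_seq [RHS]big_seq; apply: eq_bigr => z zs.
by rewrite rmorphB /= map_polyX map_polyC /= real_s.
Qed.

(** At a positive point the leading monomial is positive and no other monomial
    is negative. *)
Lemma nonneg_coefs_root_le0 p a : nonneg_coefs p -> p != 0 -> root p a -> a <= 0.
Proof.
move=> pge0 p0 /rootP; rewrite leNgt => pa; apply/negP => a0.
have : 0 < p.[a].
  rewrite horner_coef.
  have szp : ((size p).-1 < size p)%N by rewrite prednK ?size_poly_gt0.
  rewrite (bigD1 (Ordinal szp)) //= ltr_wpDr //.
    by apply: sumr_ge0 => i _; rewrite mulr_ge0 ?exprn_ge0 ?pge0 // ltW.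
  by rewrite mulr_gt0 ?exprn_gt0 // lt_def pge0 -lead_coefE lead_coef_eq0 p0.
by rewrite pa ltxx.
Qed.

(** The operator [g - X d/dX]: it multiplies the coefficient of degree [i] by
    [g - i], so products of such operators realise any real-rooted polynomial
    in the degree as a coefficient multiplier. *)
Definition euler_op g p := g *: p - 'X * p^`().

Lemma coef_euler_op g p i : (euler_op g p)`_i = (g - i%:R) * p`_i.
Proof.
rewrite coefB coefXM coefZ coef_deriv; case: i => [|i] /=.
  by ring.
by rewrite -mulr_natl; ring.
Qed.

Lemma Im_sum I (r : seq I) (F : I -> R[i]) :
  Im (\sum_(i <- r) F i) = \sum_(i <- r) Im (F i).
Proof. by elim/big_rec2: _ => // i y z _ <-; case: (F i); case: z. Qed.

Lemma Im_ratio (a : R) z : Im z != 0 ->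
  Im (z / (z - (real_complex R a))) = - a * Im z / ((Re z - a) ^+ 2 + Im z ^+ 2).
Proof.
case: z => x y /= y0; rewrite /= ?subr0 ?oppr0 ?addr0.
have : (x - a) ^+ 2 + y ^+ 2 != 0.
  by rewrite gt_eqF // ltr_wpDl ?sqr_ge0 // exprn_even_gt0.
by move=> h; field.
Qed.

Lemma deriv_prod_ratio (K : fieldType) (s : seq K) (z : K) :
  all (fun a => z != a) s ->
  (\prod_(a <- s) ('X - a%:P))^`().[z] =
  (\prod_(a <- s) ('X - a%:P)).[z] * \sum_(a <- s) (z - a)^-1.
Proof.
elim: s => [|a s IH] /=; first by rewrite !big_nil derivC hornerC mulr0.
move=> /andP[za /IH E]; rewrite !big_cons derivM derivXsubC !hornerE E.
by have : z - a != 0; [rewrite subr_eq0 | move=> h; field].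
Qed.

(** Logarithmic differentiation: if [p] has the roots [a_i], then [euler_op g p]
    takes at [z] the value [p(z) * (g - sum_i z / (z - a_i))]. The roots are
    nonpositive, so the imaginary part of each [z / (z - a_i)] is a nonnegative
    multiple of [Im z], and a positive one as soon as [a_i < 0]; the bracket then
    does not vanish off the real axis. If all roots are [0], then [p] is a
    multiple of a power of [X], hence an eigenvector of the operator. *)
Lemma real_stable_euler_op g p : nonneg_coefs p -> real_stable p ->
  euler_op g p != 0 -> real_stable (euler_op g p).
Proof.
move=> pge0 st q0.
have p0 := real_stable_neq0 st; have [s Es] := real_stable_split st.
have lp0 : lead_coef p != 0 by rewrite lead_coef_eq0.
have s_le0 a : a \in s -> a <= 0.
  move=> sa; apply: (@nonneg_coefs_root_le0 p) => //.
  by rewrite Es rootZ // root_prod_XsubC.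
have [/allP s0|/allPn[a sa an0]] := boolP (all (fun a => a == 0) s).
  have Ep : p = lead_coef p *: 'X^(size s).
    rewrite {1}Es; congr (_ *: _); rewrite big_seq.
    rewrite (eq_bigr (fun=> 'X)) => [|a /s0/eqP->]; last by rewrite subr0.
    by rewrite -big_seq big_const_seq count_predT iter_mulr_1.
  have Eq : euler_op g p = (g - (size s)%:R) *: p.
    apply/polyP=> i; rewrite coef_euler_op coefZ Ep coefZ coefXn.
    by case: eqP => [->|]; rewrite ?mulr0.
  have g0 : g - (size s)%:R != 0.
    by apply: contraNneq q0 => e; rewrite Eq e scale0r.
  by move=> z /st; rewrite Eq /toC map_polyZ rootZ // fmorph_eq0.
move=> z z0; have pz := st z z0.
pose sC := [seq real_complex R b | b <- s].
have EC : toC p = (real_complex R (lead_coef p)) *: \prod_(b <- sC) ('X - b%:P).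
  rewrite {1}Es /toC map_polyZ rmorph_prod big_map /=; congr (_ *: _).
  by apply: eq_bigr => b _; rewrite rmorphB /= map_polyX map_polyC.
have zsC : all (fun b => z != b) sC.
  by apply/allP=> _ /mapP[b _ ->]; apply: contraNneq z0 => ->.
have E : (toC (euler_op g p)).[z] =
   (toC p).[z] * (real_complex R g - \sum_(b <- sC) z / (z - b)).
  rewrite /toC /euler_op rmorphB rmorphM /= map_polyX map_polyZ -deriv_map -/(toC p).
  rewrite !hornerE mulrBr [in RHS]mulrC; congr (_ - _).
  rewrite EC derivZ !hornerZ deriv_prod_ratio // -mulr_sumr; ring.
rewrite /root E mulf_neq0 //.
rewrite subr_eq0 eq_sym; apply/negP => /eqP /(congr1 (@Im R)); rewrite Im_sum big_map /=.
move=> /eqP; apply/negP.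
rewrite (eq_bigr (fun b => Im z * (- b / ((Re z - b) ^+ 2 + Im z ^+ 2)))); last first.
  by move=> b _; rewrite Im_ratio //; ring.
rewrite -mulr_sumr mulf_neq0 // gt_eqF //.
have den b : 0 < (Re z - b) ^+ 2 + Im z ^+ 2.
  by rewrite ltr_wpDl ?sqr_ge0 // exprn_even_gt0.
rewrite (big_rem a) //= ltr_pwDl //.
  by rewrite divr_gt0 // oppr_gt0 lt_def eq_sym an0 s_le0.
rewrite big_seq; apply: sumr_ge0 => b /mem_rem sb.
by rewrite divr_ge0 ?oppr_ge0 ?s_le0 // ltW.
Qed.

Lemma real_stable_comp_XsubC c p : real_stable p -> real_stable (p \Po ('X - c%:P)).
Proof.
move=> st z z0; rewrite /toC map_comp_poly rmorphB /= map_polyX map_polyC /=.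
rewrite /root horner_comp hornerXsubC; apply: st.
by case: z z0 => x y /=; rewrite subr0.
Qed.

(** The generating polynomial of a Bernoulli variable of parameter [a]. *)
Definition bernoulli_poly (a : R) : {poly R} := (1 - a)%:P + a *: 'X.

(** A polynomial with nonnegative coefficients and only real zeros is, after
    normalisation at [1], the generating polynomial of a sum of independent
    Bernoulli variables: every root [b] is nonpositive, and [X - b] is
    proportional to the generating polynomial of parameter [1 / (1 - b)]. *)
Lemma real_stable_bernoulli p : nonneg_coefs p -> real_stable p ->
  exists2 s : seq R, all (fun a => 0 <= a <= 1) s &
    p = p.[1] *: \prod_(a <- s) bernoulli_poly a.
Proof.
move=> pge0 st; have [s Es] := real_stable_split st.
have p0 := real_stable_neq0 st.
have s_le0 b : b \in s -> b <= 0.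
  move=> sb; apply: (@nonneg_coefs_root_le0 p) => //.
  by rewrite Es rootZ ?lead_coef_eq0 // root_prod_XsubC.
pose t := [seq (1 - b)^-1 | b <- s].
have [c Ec] : exists c, p = c *: \prod_(a <- t) bernoulli_poly a.
  exists (lead_coef p * \prod_(b <- s) (1 - b)).
  rewrite -scalerA {1}Es; congr (_ *: _); rewrite big_map.
  rewrite -scaler_prod; apply: eq_big_seq => b /s_le0 b0; rewrite /bernoulli_poly.
  have nz : 1 - b != 0 by rewrite gt_eqF //; lra.
  rewrite scalerDr scalerA divff // scale1r -mul_polyC -polyCM addrC.
  rewrite mulrBr mulr1 divff //; congr (_ + _); rewrite -polyCN; congr _%:P; ring.
exists t.
  apply/allP => _ /mapP[b /s_le0 b0 ->].
  by rewrite invr_ge0 invf_le1; lra.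
rewrite {1}Ec; congr (_ *: _); rewrite Ec hornerZ horner_prod.
rewrite big1 ?mulr1 // => a _.
by rewrite /bernoulli_poly !hornerE; ring.
Qed.

End RealStable.

(** * The generating polynomial of the number of isolated vertices *)

Section IsolatedPolynomial.
Variable R : realType.
Variable n : nat.

(** Up to the factor [#|ER_support n m|], the generating polynomial of the
    binomial moments of the number of isolated vertices: each of the ['C(n, k)]
    sets of [k] vertices is avoided by ['C('C(n - k, 2), m)] graphs. *)
Definition moment_poly m : {poly R} :=
  \poly_(k < n.+1) ('C(n, k) * 'C('C(n - k, 2), m))%:R.

Definition isolated_poly m : {poly R} := \sum_(G in ER_support n m) 'X^(nb_isolated G).

(** The vertices of [S] are isolated exactly when all edges are pairs of vertices
    outside [S]. *)
Lemma card_avoiding m (S : {set 'I_n}) :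
  #|[set G in ER_support n m | S \subset [set v | Defs.isolated G v]]| =
  'C('C(n - #|S|, 2), m).
Proof.
have -> : 'C(n - #|S|, 2) = #|[set e : {set 'I_n} | e \subset ~: S & #|e| == 2]|.
  by rewrite cards_draws [#|~: S|]cardsCs finset.setCK card_ord.
rewrite -cards_draws; apply: eq_card => G; rewrite !inE /simple_graph.
apply/idP/idP.
  move=> /andP[/andP[/forall_inP sG ->] /fintype.subsetP iS]; rewrite andbT.
  apply/fintype.subsetP => e eG; rewrite inE sG // andbT; apply/fintype.subsetP => v ve.
  rewrite inE; apply/negP => /iS.
  rewrite inE /Defs.isolated /degree cards_eq0 => /eqP/setP/(_ e).
  by rewrite !inE eG ve.
move=> /andP[/fintype.subsetP GA ->]; rewrite andbT; apply/andP; split.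
  by apply/forall_inP => e /GA; rewrite inE => /andP[].
apply/fintype.subsetP => v vS; rewrite inE /Defs.isolated /degree cards_eq0.
apply/eqP/setP=> e.
rewrite !inE; apply/negP => /andP[/GA]; rewrite inE => /andP[/fintype.subsetP eS _].
by move=> /eS; rewrite inE vS.
Qed.

Lemma sum_subsets_exp (K : comNzRingType) (T : finType) (A : {set T}) (y : K) :
  \sum_(S : {set T} | S \subset A) y ^+ #|S| = (1 + y) ^+ #|A|.
Proof.
rewrite exprDn (partition_big (fun S : {set T} => inord #|S| : 'I_#|A|.+1) xpredT) //=.
apply: eq_bigr => i _; rewrite expr1n mul1r.
rewrite (eq_bigl [in [set S : {set T} | S \subset A & #|S| == i]]); last first.
  move=> S; rewrite !inE; case SA: (S \subset A) => //=.
  rewrite -val_eqE /= inordK // ltnS subset_leq_card //.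
rewrite (eq_bigr (fun=> y ^+ i)) => [|S]; last by rewrite inE => /andP[_ /eqP->].
by rewrite sumr_const cards_draws.
Qed.

(** Inclusion-exclusion: expand [X^k = (1 + (X - 1))^k] over the sets of isolated
    vertices and exchange the two summations. *)
Lemma isolated_polyE m : isolated_poly m = moment_poly m \Po ('X - 1%:P).
Proof.
rewrite /isolated_poly /nb_isolated.
under eq_bigr => G _ do rewrite -[X in X ^+ _](subrK 1 'X) addrC -sum_subsets_exp.
rewrite (exchange_big_dep xpredT) //=.
rewrite (eq_bigr (fun S : {set 'I_n} => ('X - 1) ^+ #|S| *+ 'C('C(n - #|S|, 2), m))).
  2: move=> S _; rewrite -card_avoiding -sumr_const; apply: eq_bigl => G.
  2: by rewrite [in RHS]inE.
rewrite /moment_poly poly_def raddf_sum /=.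
rewrite (partition_big (fun S : {set 'I_n} => inord #|S| : 'I_n.+1) xpredT) //=.
apply: eq_bigr => i _; rewrite comp_polyZ comp_Xn_poly.
have h (S : {set 'I_n}) :
    (inord #|S| == i :> 'I_n.+1) = (S \in [set S : {set 'I_n} | #|S| == i]).
  by rewrite inE -val_eqE /= inordK // ltnS -[X in (_ <= X)%N](card_ord n) max_card.
rewrite (eq_bigl _ _ h) (eq_bigr (fun=> ('X - 1%:P) ^+ i *+ 'C('C(n - i, 2), m))).
  by rewrite sumr_const card_draws card_ord -mulrnA mulnC scaler_nat.
by move=> S; rewrite inE => /eqP->.
Qed.

Lemma moment_poly0 : moment_poly 0 = (1 + 'X) ^+ n.
Proof.
rewrite /moment_poly exprDn poly_def; apply: eq_bigr => i _.
by rewrite expr1n mul1r bin0 muln1 scaler_nat.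
Qed.

Lemma coef_moment_poly m k : (moment_poly m)`_k =
  if (k < n.+1)%N then ('C(n, k) * 'C('C(n - k, 2), m))%:R else 0.
Proof. by rewrite coef_poly. Qed.

Lemma nonneg_moment_poly m : nonneg_coefs (moment_poly m).
Proof. by move=> k; rewrite coef_moment_poly; case: ifP. Qed.

Lemma natr_bin2 k : 'C(k, 2)%:R = k%:R * (k%:R - 1) / 2 :> R.
Proof.
case: k => [|k]; first by rewrite bin0n mul0r mul0r.
have := mul_bin_diag k.+1 1; rewrite bin1 => /(congr1 (fun x => x%:R : R)).
by rewrite !natrM -[k.+1%:R]natr1 => h; lra.
Qed.

(** By [m.+1 * 'C(N, m.+1) = (N - m) * 'C(N, m)], passing from [m] to [m.+1]
    multiplies the coefficient of degree [k] by ['C(n - k, 2) - m] up to a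
    constant. With [j = n - k] twice this factor is [(j - a) * (j + a - 1)], where
    [a] is the positive solution of [a * (a - 1) = 2 * m]. *)
Lemma moment_polyS m (a := (1 + Num.sqrt (1 + 8 * m%:R)) / 2) :
  (2 * m.+1%:R) *: moment_poly m.+1 =
  euler_op (n%:R - a) (euler_op (n%:R + a - 1) (moment_poly m)).
Proof.
apply/polyP => k; rewrite coefZ !coef_euler_op !coef_moment_poly.
case: ifP => [kn|_]; last by rewrite !mulr0.
have aE : a * (a - 1) = 2 * m%:R.
  have : Num.sqrt (1 + 8 * m%:R : R) ^+ 2 = 1 + 8 * m%:R.
    by rewrite sqr_sqrtr // ltr_wpDr ?ltW.
  by rewrite /a expr2 => h; lra.
have bE : m.+1%:R * 'C('C(n - k, 2), m.+1)%:R =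
    ('C(n - k, 2)%:R - m%:R) * 'C('C(n - k, 2), m)%:R :> R.
  rewrite -natrM mul_bin_left natrM.
  have [le|lt] := leqP m 'C(n - k, 2); first by rewrite natrB.
  by rewrite (bin_small lt) !mulr0.
have nk : (n - k)%:R = n%:R - k%:R :> R by rewrite natrB.
move: bE; rewrite natr_bin2 nk !natrM => bE.
transitivity (2 * 'C(n, k)%:R * (m.+1%:R * 'C('C(n - k, 2), m.+1)%:R) : R).
  by ring.
rewrite bE.
transitivity (((n%:R - k%:R) * (n%:R - k%:R - 1) - (2 * m%:R)) *
  ('C(n, k)%:R * 'C('C(n - k, 2), m)%:R) : R).
  by field.
rewrite -aE; ring.
Qed.

Lemma moment_poly_neq0 m : (m <= 'C(n, 2))%N -> (moment_poly m)`_0 != 0.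
Proof.
by move=> h; rewrite coef_moment_poly /= bin0 mul1n subn0 pnatr_eq0 -lt0n bin_gt0.
Qed.

(** Induction on [m] through [moment_polyS]. Of the two factors there,
    [j + a - 1] is applied first: it is nonnegative, hence keeps the coefficients
    nonnegative, and [real_stable_euler_op] can then be used for the factor
    [j - a], whose sign varies. *)
Lemma real_stable_moment_poly m : (m <= 'C(n, 2))%N -> real_stable (moment_poly m).
Proof.
elim: m => [_|m IH lt].
  rewrite moment_poly0 => z z0; rewrite /toC rmorphXn rmorphD rmorph1 /= map_polyX.
  rewrite /root hornerE !hornerE expf_neq0 //.
  apply: contraNneq z0 => /(congr1 (@complex.Im R)).
  by case: z => x y /=; rewrite add0r => ->.
set a : R := (1 + Num.sqrt (1 + 8 * m%:R)) / 2.
have a1 : 1 <= a.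
  have : 1 <= Num.sqrt (1 + 8 * m%:R : R).
    by rewrite -[X in X <= _]sqrtr1 ler_sqrt ?lerDl ?mulr_ge0 // ltr_wpDr // mulr_ge0.
  by rewrite /a; lra.
(* The constant coefficient survives as long as [m < 'C(n, 2)], which keeps every
   polynomial involved nonzero. *)
have q0 : 0 < (euler_op (n%:R - a) (euler_op (n%:R + a - 1) (moment_poly m)))`_0.
  rewrite -moment_polyS coefZ mulr_gt0 // lt_def moment_poly_neq0 //.
  exact: nonneg_moment_poly.
have q1 : euler_op (n%:R + a - 1) (moment_poly m) != 0.
  by apply: contraTneq q0 => ->; rewrite coef_euler_op coef0 mulr0 ltxx.
have st2 : real_stable (euler_op (n%:R + a - 1) (moment_poly m)).
  by apply: real_stable_euler_op => //; [exact: nonneg_moment_poly | exact: IH (ltnW lt)].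
have nn2 : nonneg_coefs (euler_op (n%:R + a - 1) (moment_poly m)).
  move=> k; rewrite coef_euler_op coef_moment_poly.
  case: ifP => [kn|_]; last by rewrite mulr0.
  have : k%:R <= n%:R :> R by rewrite ler_nat.
  by move=> kn'; apply: mulr_ge0 => //; lra.
have := @real_stable_euler_op _ (n%:R - a) _ nn2 st2.
rewrite -moment_polyS => H z z0.
have /H/(_ z z0) : (2 * m.+1%:R) *: moment_poly m.+1 != 0.
  by apply: contraTneq q0 => e; rewrite -moment_polyS e coef0 ltxx.
by rewrite /toC map_polyZ rootZ // fmorph_eq0 mulf_neq0 // pnatr_eq0.
Qed.

End IsolatedPolynomial.

(** * Stein's identity for sums of independent Bernoulli variables *)

Section WSum.
Variable R : rcfType.
Implicit Types (p q : {poly R}) (g h : nat -> R).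

(** The mean of [g] under the (possibly unnormalised) law on [nat] with generating
    polynomial [p]. *)
Definition wsum p g : R := \sum_(i < size p) p`_i * g i.

Lemma wsumE N p g : (size p <= N)%N -> wsum p g = \sum_(i < N) p`_i * g i.
Proof.
move=> le; rewrite /wsum (big_ord_widen N (fun i => p`_i * g i)) //.
rewrite [RHS](bigID (fun i : 'I_N => (i < size p)%N)) /= [X in _ + X]big1 ?addr0 //.
by move=> i; rewrite -leqNgt => /(nth_default 0) ->; rewrite mul0r.
Qed.

Lemma wsumD p q g : wsum (p + q) g = wsum p g + wsum q g.
Proof.
pose N := maxn (size p) (size q).
rewrite (@wsumE N) ?size_polyD // (@wsumE N p) ?leq_maxl // (@wsumE N q) ?leq_maxr //.
by rewrite -big_split; apply: eq_bigr => i _; rewrite coefD mulrDl.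
Qed.

Lemma wsumZ c p g : wsum (c *: p) g = c * wsum p g.
Proof.
rewrite (@wsumE (size p)) ?size_scale_leq // mulr_sumr.
by apply: eq_bigr => i _; rewrite coefZ mulrA.
Qed.

Lemma wsumB p q g : wsum (p - q) g = wsum p g - wsum q g.
Proof. by rewrite wsumD -scaleN1r wsumZ mulN1r. Qed.

Lemma wsumXM p g : wsum ('X * p) g = wsum p (g \o succn).
Proof.
rewrite mulrC (@wsumE (size p).+1) ?size_mulX_leq //.
  rewrite big_ord_recl coefMX mul0r add0r.
  by apply: eq_bigr => i _; rewrite coefMX.
by have [->|p0] := eqVneq p 0; rewrite ?mul0r ?size_poly0 // size_mulX.
Qed.

Lemma wsumXderiv p g : wsum ('X * p^`()) g = wsum p (fun k => k%:R * g k).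
Proof.
rewrite (@wsumE (size p)).
  apply: eq_bigr => i _; rewrite mulrA; congr (_ * _).
  by rewrite coefXM coef_deriv; case: (i : nat) => [|j] /=; rewrite ?mulr0 // mulr_natr.
rewrite mulrC; have [->|p0] := eqVneq (p^`()) 0; first by rewrite mul0r size_poly0.
rewrite size_mulX //; apply: lt_size_deriv.
by apply: contraNneq p0 => ->; rewrite derivC.
Qed.

Lemma eq_wsum p g h : g =1 h -> wsum p g = wsum p h.
Proof. by move=> e; apply: eq_bigr => i _; rewrite e. Qed.

Lemma wsumDr p g h : wsum p (fun k => g k + h k) = wsum p g + wsum p h.
Proof. by rewrite -big_split; apply: eq_bigr => i _; rewrite mulrDr. Qed.

Lemma wsumZr c p g : wsum p (fun k => c * g k) = c * wsum p g.
Proof. by rewrite mulr_sumr; apply: eq_bigr => i _; rewrite mulrCA. Qed.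

Lemma wsumBr p g h : wsum p (fun k => g k - h k) = wsum p g - wsum p h.
Proof. by rewrite -sumrB; apply: eq_bigr => i _; rewrite mulrBr. Qed.

Lemma wsum1 p : wsum p (fun=> 1) = p.[1].
Proof. by rewrite horner_coef; apply: eq_bigr => i _; rewrite expr1n. Qed.

Lemma le_wsum p g h : nonneg_coefs p -> (forall k, g k <= h k) ->
  wsum p g <= wsum p h.
Proof. by move=> p0 le; apply: ler_sum => i _; rewrite ler_wpM2l. Qed.

Lemma ler_norm_wsum p g h : nonneg_coefs p -> (forall k, `|g k| <= h k) ->
  `|wsum p g| <= wsum p h.
Proof.
move=> p0 le; apply: (le_trans (ler_norm_sum _ _ _)); apply: ler_sum => i _.
by rewrite normrM ger0_norm ?ler_wpM2l.
Qed.

Lemma nonneg_coefsD p q : nonneg_coefs p -> nonneg_coefs q -> nonneg_coefs (p + q).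
Proof. by move=> p0 q0 i; rewrite coefD addr_ge0. Qed.

Lemma nonneg_coefsZ c p : 0 <= c -> nonneg_coefs p -> nonneg_coefs (c *: p).
Proof. by move=> c0 p0 i; rewrite coefZ mulr_ge0. Qed.

Lemma nonneg_coefsM p q : nonneg_coefs p -> nonneg_coefs q -> nonneg_coefs (p * q).
Proof. by move=> p0 q0 i; rewrite coefM sumr_ge0 // => j _; rewrite mulr_ge0. Qed.

Lemma nonneg_bernoulli (a : R) : 0 <= a <= 1 -> nonneg_coefs (bernoulli_poly a).
Proof.
move=> /andP[a0 a1] i; rewrite coefD coefC coefZ coefX addr_ge0 //.
  by case: ifP => // _; lra.
by rewrite mulr_ge0.
Qed.

(** For a sum of independent Bernoulli variables [X_i] of parameters [a_i], with
    [P_i] the generating polynomial of the sum without [X_i], take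
    [A = sum_i a_i (1 - a_i)^2 P_i] and [B = sum_i a_i^2 (1 - a_i) P_i], the parts of
    [sum_i a_i (1 - a_i) P_i] where [X_i = 0] and where [X_i = 1]. Then [sd_mean]
    is Stein's identity and [sd_var] says that putting [X_i] back recovers the law
    [p], with the variance [v] as total weight. *)
Record stein_dec p (A B : {poly R}) (mu v : R) : Prop := SteinDec {
  sd_p : nonneg_coefs p;
  sd_1 : p.[1] = 1;
  sd_A : nonneg_coefs A;
  sd_B : nonneg_coefs B;
  sd_mean : 'X * p^`() - mu *: p = ('X - 1) * (A + B);
  sd_var : v *: p = A + 'X * B;
  sd_le : v <= mu }.

(** One more factor [(1 - a) + a X] multiplies every [P_i] in [A] and [B] by it and
    contributes a new term in which [P_i] is the old [p]. *)
Lemma bernoulli_stein_dec (s : seq R) : all (fun a => 0 <= a <= 1) s ->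
  exists A B mu v, stein_dec (\prod_(a <- s) bernoulli_poly a) A B mu v.
Proof.
elim: s => [_|a s IH /= /andP[a01 /IH [A [B [mu [v [p0 p1 A0 B0 Em Ev lev]]]]]]].
  exists 0, 0, 0, 0; rewrite big_nil; split => //.
  - by move=> i; rewrite coef1 ler0n.
  - by rewrite hornerC.
  - by move=> i; rewrite coef0.
  - by move=> i; rewrite coef0.
  - by rewrite derivC scale0r; ring.
  - by rewrite scale0r; ring.
rewrite big_cons; set p := \prod_(_ <- s) _ in p0 p1 Em Ev *.
have b0 := nonneg_bernoulli a01; case/andP: a01 => a0 a1.
have c0 : 0 <= a * (1 - a) by rewrite mulr_ge0 // subr_ge0.
exists (bernoulli_poly a * A + (a * (1 - a) * (1 - a)) *: p),
       (bernoulli_poly a * B + (a * (1 - a) * a) *: p),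
       (mu + a), (v + a * (1 - a)); split.
- exact: nonneg_coefsM.
- by rewrite hornerM p1 mulr1 /bernoulli_poly !hornerE; ring.
- apply: nonneg_coefsD; first exact: nonneg_coefsM.
  by apply: nonneg_coefsZ => //; rewrite mulr_ge0 // subr_ge0.
- apply: nonneg_coefsD; first exact: nonneg_coefsM.
  by apply: nonneg_coefsZ => //; rewrite mulr_ge0.
- rewrite derivM.
  have -> : (bernoulli_poly a)^`() = a%:P.
    by rewrite /bernoulli_poly derivD derivC derivZ derivX add0r -mul_polyC mulr1.
  have -> : 'X * (a%:P * p + bernoulli_poly a * p^`()) - (mu + a) *: (bernoulli_poly a * p) =
      bernoulli_poly a * ('X * p^`() - mu *: p) + (a%:P * 'X * p - a *: (bernoulli_poly a * p)).
    rewrite -!mul_polyC rmorphD /=; ring.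
  rewrite Em /bernoulli_poly -!mul_polyC !rmorphM !rmorphB /= rmorph1; ring.
- rewrite scalerDl -[v *: _]mul_polyC mulrCA mul_polyC Ev.
  rewrite /bernoulli_poly -!mul_polyC !rmorphM !rmorphB /= rmorph1; ring.
- by apply: lerD => //; rewrite ler_piMr // lerBlDr lerDl.
Qed.

Section SteinMethod.
Variables (p A B : {poly R}) (mu v : R).
Hypothesis dec : stein_dec p A B mu v.

(** Read on test functions, [X * p^`()] weighs [g k] by [k] and multiplication by
    [X - 1] is a finite difference. *)
Lemma stein_identity g :
  wsum p (fun k => (k%:R - mu) * g k) =
  wsum A (fun k => g k.+1 - g k) + wsum B (fun k => g k.+1 - g k).
Proof.
have := congr1 (wsum ^~ g) (sd_mean dec).
rewrite /= mulrBl mul1r !wsumB wsumZ wsumXderiv wsumXM !wsumD -wsumZr -wsumBr => E.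
rewrite !wsumBr addrACA -opprD -[RHS]E; apply: eq_wsum => k; ring.
Qed.

Lemma variance_identity h :
  v * wsum p h = wsum A h + wsum B (h \o succn).
Proof. by rewrite -wsumZ (sd_var dec) wsumD wsumXM. Qed.

Lemma variance_wsum : wsum p (fun k => (k%:R - mu) ^+ 2) = v.
Proof.
have := variance_identity (fun=> 1); rewrite wsum1 (sd_1 dec) mulr1 => ->.
rewrite (stein_identity (fun k => k%:R - mu)) /=; congr (_ + _); apply: eq_wsum => k.
all: by rewrite -natr1 /=; ring.
Qed.

Lemma mean_wsum : wsum p (fun k => k%:R) = mu.
Proof.
have w0 C : wsum C (fun=> 1 - 1) = 0 by rewrite wsumBr subrr.
have := stein_identity (fun=> 1); rewrite !w0 addr0.
rewrite (@eq_wsum p _ (fun k => k%:R - mu * 1)); last by move=> k; ring.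
rewrite wsumBr wsumZr wsum1 (sd_1 dec) mulr1.
by move/eqP; rewrite subr_eq0 => /eqP.
Qed.

Variable d : R.
Hypothesis (d_gt0 : 0 < d) (d_var : d ^+ 2 * v = 1).

(* The standardised value of [k], with [d] the inverse standard deviation. *)
Let w (k : nat) : R := (k%:R - mu) * d.

Let wS k : w k.+1 = w k + d.
Proof. by rewrite /w -natr1; ring. Qed.

Lemma second_moment : wsum p (fun k => 1 + w k ^+ 2) = 2.
Proof.
rewrite wsumDr wsum1 (sd_1 dec).
rewrite (@eq_wsum p _ (fun k => d ^+ 2 * (k%:R - mu) ^+ 2)); last first.
  by move=> k; rewrite /w; ring.
by rewrite wsumZr variance_wsum d_var; ring.
Qed.

Lemma stein_identity_std g :
  wsum p (fun k => w k * g k) =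
  d * (wsum A (fun k => g k.+1 - g k) + wsum B (fun k => g k.+1 - g k)).
Proof.
rewrite -stein_identity -wsumZr; apply: eq_wsum => k; rewrite /w; ring.
Qed.

(** Stein's identity for the identity function truncated to a window of radius
    [2 * d] around [z]: one step of size [d] starting or ending within [d] of [z]
    gains exactly [d], other steps lose nothing, and the truncated function is
    bounded by [2 * d]. *)
Lemma concentration (z : R) : wsum p (fun k => (`|w k - z| <= d)%R%:R) <= 2 * d.
Proof.
pose f x := Num.min (2 * d) (Num.max (- (2 * d)) (x - z)).
have dd : - (2 * d) <= 2 * d by move: d_gt0; lra.
have fP x : [\/ x - z <= - (2 * d) /\ f x = - (2 * d),
     - (2 * d) <= x - z <= 2 * d /\ f x = x - z | 2 * d <= x - z /\ f x = 2 * d].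
  rewrite /f; case: (leP (- (2 * d)) (x - z)) => h1.
    by case: (leP (2 * d) (x - z)) => h2; [apply: Or33 | apply: Or32; split=> //; lra].
  apply: Or31; split; first exact: ltW.
  by rewrite min_r.
have f_ub x : `|f x| <= 2 * d by rewrite ler_norml; case: (fP x) => -[h ->]; lra.
have f_incr x y : (y == x) || (y == x + d) ->
    d * (`|y - z| <= d)%R%:R <= f (x + d) - f x.
  case: (lerP `|y - z| d) => [|_]; last first.
    by move=> _; case: (fP x) => -[? ->]; case: (fP (x + d)) => -[? ->] /=; lra.
  rewrite ler_norml => /andP[l u] /orP[]/eqP e; rewrite e in l u; rewrite mulr1.
    by case: (fP x) => -[? ->]; case: (fP (x + d)) => -[? ->] /=; lra.
  by case: (fP x) => -[? ->]; case: (fP (x + d)) => -[? ->] /=; lra.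
have := stein_identity_std (f \o w).
(* [|w| <= (1 + w^2) / 2], and the mean of [1 + w^2] is [2]. *)
have le2 : wsum p (fun k => w k * (f \o w) k) <= 2 * d.
  have -> : 2 * d = d * wsum p (fun k => 1 + w k ^+ 2) by rewrite second_moment; ring.
  rewrite -wsumZr; apply: le_wsum; first exact: sd_p dec.
  move=> k /=; apply: (le_trans (ler_norm _)); rewrite normrM.
  apply: (@le_trans _ _ (`|w k| * (2 * d))); first by rewrite ler_wpM2l.
  have : 0 <= (1 - `|w k|) ^+ 2 by rewrite sqr_ge0.
  rewrite sqrrB expr1n mul1r -[w k ^+ 2]real_normK ?num_real // => h; nra.
move=> E; rewrite E in le2.
apply: le_trans le2.
have v_gt0 : 0 < v by have := d_var; have := sqr_ge0 d => *; nra.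
have -> : wsum p (fun k => (`|w k - z| <= d)%R%:R) =
    d * (d * (v * wsum p (fun k => (`|w k - z| <= d)%R%:R))).
  by rewrite !mulrA -expr2 d_var mul1r.
apply: ler_wpM2l; first exact: ltW.
rewrite variance_identity mulrDr -!wsumZr; apply: lerD.
  apply: le_wsum => [|k]; first exact: sd_A dec.
  by rewrite /= wS; apply: f_incr; rewrite eqxx.
apply: le_wsum => [|k]; first exact: sd_B dec.
by rewrite /= wS; apply: f_incr; rewrite eqxx orbT.
Qed.

(** Stein's method for a function [f] with prescribed derivative [h]: [sd_var]
    averages [h] over the two ends of a step of size [d], while Stein's identity
    turns [w * f(w)] into the difference quotient of [f] over the same step. The
    two differ pointwise by the assumed bound, whose mean is controlled by the
    second moment and by [concentration]. *)
Lemma stein_bound (f h : R -> R) (z K : R) :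
  (forall x c, (c == x) || (c == x + d) ->
    `|h c - (f (x + d) - f x) / d| <= K * (d * (1 + c ^+ 2) + (`|c - z| <= d)%R%:R)) ->
  0 <= K ->
  `|wsum p (fun k => h (w k) - w k * f (w k))| <= 4 * K * d.
Proof.
move=> fh K0.
pose u c := K * (d * (1 + c ^+ 2) + (`|c - z| <= d)%R%:R).
pose D k := (f (w k.+1) - f (w k)) / d.
have v_gt0 : 0 < v by have := d_var; have := sqr_ge0 d => *; nra.
have dn0 : d != 0 by rewrite gt_eqF.
have E : v * wsum p (fun k => h (w k) - w k * f (w k)) =
    wsum A (fun k => h (w k) - D k) + wsum B (fun k => h (w k.+1) - D k).
  have eD C : wsum C D = d^-1 * wsum C (fun k => f (w k.+1) - f (w k)).
    by rewrite -wsumZr; apply: eq_wsum => k; rewrite /D mulrC.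
  rewrite !wsumBr mulrBr variance_identity (stein_identity_std (f \o w)) !eD /=.
  have -> : d^-1 = v * d by rewrite -[LHS]mul1r -d_var; field.
  by rewrite /comp; ring.
have le : `|v * wsum p (fun k => h (w k) - w k * f (w k))| <= v * wsum p (u \o w).
  rewrite E variance_identity; apply: (le_trans (ler_normD _ _)); apply: lerD.
    apply: ler_norm_wsum => [|k]; first exact: sd_A dec.
    by rewrite /D /= wS; apply: fh; rewrite eqxx.
  apply: ler_norm_wsum => [|k]; first exact: sd_B dec.
  by rewrite /D /= wS; apply: fh; rewrite eqxx orbT.
move: le; rewrite normrM gtr0_norm // ler_pM2l // => le; apply: (le_trans le).
rewrite wsumZr wsumDr wsumZr second_moment.
have := ler_wpM2l K0 (concentration z); lra.
Qed.

End SteinMethod.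

End WSum.

(** * The solution of Stein's equation *)

Section Gauss.
Import numFieldNormedType.Exports.
Local Open Scope classical_set_scope.
Local Open Scope ring_scope.
Variable R : realType.
Implicit Types x y z w a b c : R.

Lemma MVT_global (f df : R -> R) a b : a <= b ->
  (forall x, is_derive x 1 f (df x)) ->
  exists2 c, a <= c <= b & f b - f a = df c * (b - a).
Proof.
move=> ab fd.
have fc : {within `[a, b], continuous f}.
  apply: continuous_subspaceT => x; apply: differentiable_continuous.
  by apply/derivable1_diffP; have [] := fd x.
have [c cab eq] := MVT_segment ab (fun x _ => fd x) fc.
by exists c => //; rewrite in_itv in cab.
Qed.

Lemma is_derive_halfsq x : is_derive x 1 (fun y : R => y ^+ 2 / 2) x.
Proof.
have -> : (fun y : R => y ^+ 2 / 2) = (fun y => 2^-1 *: (id y ^+ 2)).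
  by apply/funext => y /=; rewrite mulrC.
apply: is_derive_eq; rewrite /GRing.scale /=; lra.
Qed.

Let phi (x : R) := normal_pdf 0 1 x.

(** The reciprocal of the standard normal density. *)
Definition pdf_inv x : R := (normal_peak (1:R))^-1 * expR (x ^+ 2 / 2).

Lemma phiE x : phi x = normal_peak (1 : R) * expR (- (x ^+ 2 / 2)).
Proof.
rewrite /phi normal_pdfE ?oner_neq0 // /normal_fun subr0 expr1n; congr (_ * expR _).
by rewrite mulNr.
Qed.

Lemma phi_gt0 x : 0 < phi x.
Proof. by rewrite phiE mulr_gt0 ?expR_gt0 // normal_peak_gt0 // oner_neq0. Qed.

Lemma phi_pdf_inv x : phi x * pdf_inv x = 1.
Proof.
rewrite phiE /pdf_inv expRN; field.
by rewrite !gt_eqF ?expR_gt0 // normal_peak_gt0 // oner_neq0.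
Qed.

Lemma is_derive_phi x : is_derive x 1 phi (- x * phi x).
Proof.
have -> : phi = (fun x => normal_peak (1 : R) * expR (- (x ^+ 2 / 2))).
  by apply/funext => y; rewrite phiE.
have dh : is_derive x 1 (fun y : R => - (y ^+ 2 / 2)) (- x).
  exact: (is_deriveN (is_derive_halfsq x)).
have de := is_derive1_comp (is_derive_expR _) dh.
apply: (is_derive_eq (is_deriveZ (normal_peak (1 : R)) de)).
by rewrite /GRing.scale /=; ring.
Qed.

Lemma is_derive_pdf_inv x : is_derive x 1 pdf_inv (x * pdf_inv x).
Proof.
have de := is_derive1_comp (is_derive_expR _) (is_derive_halfsq x).
apply: (is_derive_eq (is_deriveZ ((normal_peak (1 : R))^-1) de)).
by rewrite /pdf_inv /GRing.scale /=; ring.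
Qed.

Lemma Phi_Rintegral x : @Phi R x =
  (\int[lebesgue_measure]_(t in [set` Interval (BInfty R true) (BRight x)]) phi t).
Proof. by rewrite /Phi /Rintegral set_itvNyc. Qed.

Lemma is_derive_Phi x : is_derive x 1 (@Phi R) (phi x).
Proof.
have -> : @Phi R = fun x =>
  (\int[lebesgue_measure]_(t in [set` Interval (BInfty R true) (BRight x)]) phi t).
  by apply/funext => y; exact: Phi_Rintegral.
have xu : x < x + 1 by rewrite ltrDl.
have ip : lebesgue_measure.-integrable [set` Interval (BInfty R true) (BRight (x + 1))]
    (EFin \o phi).
  apply: (integrableS _ _ (@subsetT _ _)) => //; exact: integrable_normal_pdf.
have cp : {for x, continuous phi} by apply: continuous_normal_pdf; rewrite oner_neq0.
have [] := continuous_FTC1 xu ip _ cp; first by rewrite ltNyr.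
move=> dF <-.
by rewrite derive1E; apply: DeriveDef.
Qed.

Let idTR : measurableTypeR R -> R := idfun.

#[local] HB.instance Definition _ :=
  @isMeasurableFun.Build _ _ _ _ idTR (@measurable_id _ _ setT).

Let idR : {RV (normal_prob (0 : R) 1) >-> R} := idTR.

Lemma cdf_Phi x : cdf idR x = (@Phi R x)%:E.
Proof.
rewrite /Phi -set_itvNyc fineK //; exact: fin_num_measure.
Qed.

Lemma Phi_ge0 x : 0 <= @Phi R x.
Proof. by rewrite -lee_fin -cdf_Phi cdf_ge0. Qed.

Lemma Phi_le1 x : @Phi R x <= 1.
Proof. by rewrite -lee_fin -cdf_Phi cdf_le1. Qed.

Lemma Phi_pinfty e : 0 < e -> \forall x \near +oo, 1 - @Phi R x < e.
Proof.
move=> e0.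
have : (@Phi R x)%:E @[x --> +oo] --> (1%:E : \bar R).
  under eq_fun do rewrite -cdf_Phi; exact: (cvg_cdfy1 idR).
move/fine_cvgP => [_] /cvgrPdist_lt /(_ e e0).
by apply: filterS => x /=; apply: le_lt_trans; exact: ler_norm.
Qed.

Lemma Phi_ninfty e : 0 < e -> \forall x \near +oo, @Phi R (- x) < e.
Proof.
move=> e0.
have : (@Phi R x)%:E @[x --> -oo] --> (0%:E : \bar R).
  under eq_fun do rewrite -cdf_Phi; exact: (cvg_cdfNy0 idR).
rewrite cvgNy_compNP => /fine_cvgP [_] /cvgrPdist_lt /(_ e e0).
by apply: filterS => x /=; rewrite sub0r normrN; apply: le_lt_trans; exact: ler_norm.
Qed.

(** [Phi x + Phi (- x)] has derivative [0] and tends to [1] at infinity. *)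
Lemma Phi_opp x : @Phi R (- x) = 1 - @Phi R x.
Proof.
pose S y := @Phi R y + @Phi R (- y).
have dS y : is_derive y 1 S 0.
  have dN := is_derive1_comp (is_derive_Phi (- y)) (is_deriveNid y 1).
  apply: (is_derive_eq (is_deriveD (is_derive_Phi y) dN)).
  by rewrite !phiE sqrrN mulrN1 subrr.
have S1 e : 0 < e -> `|1 - S x| <= e.
  move=> e0.
  have [y [xy y1 y2]] : exists y, [/\ x <= y, 1 - @Phi R y < e & @Phi R (- y) < e].
    near (pinfty_nbhs R) => y; exists y; split.
    - by near: y; by apply: nbhs_pinfty_ge; rewrite num_real.
    - by near: y; exact: Phi_pinfty.
    - by near: y; exact: Phi_ninfty.
  have [c _] := MVT_global xy dS.
  rewrite mul0r => /eqP; rewrite subr_eq0 => /eqP <-; rewrite /S ler_norml.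
  by have := Phi_ge0 y; have := Phi_ge0 (- y); have := Phi_le1 y; lra.
suff : 1 - S x = 0 by rewrite /S; lra.
by apply/eqP; rewrite -normr_le0; apply/ler_addgt0Pl => e e0; rewrite addr0; exact: S1.
Unshelve. all: by end_near.
Qed.

Lemma ndecr_Phi x y : x <= y -> @Phi R x <= @Phi R y.
Proof.
move=> xy; have [c _] := MVT_global xy is_derive_Phi.
move=> h; rewrite -subr_ge0 h mulr_ge0 ?subr_ge0 //; exact: ltW (phi_gt0 _).
Qed.

(** The derivative [(w - x) * phi x] of [phi x + w * Phi x] is nonpositive for
    [x >= w], so the value at [w] is at least the limit [w] at infinity. *)
Lemma mills w : 0 < w -> w * (1 - @Phi R w) <= phi w.
Proof.
move=> w0.
pose g x := phi x + w * @Phi R x.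
have dg x : is_derive x 1 g ((w - x) * phi x).
  apply: (is_derive_eq (is_deriveD (is_derive_phi x) (is_deriveZ w (is_derive_Phi x)))).
  by rewrite /GRing.scale /=; ring.
have ge e : 0 < e -> w * (1 - @Phi R w) <= phi w + e.
  move=> e0; have e0' : 0 < e / w by rewrite divr_gt0.
  have [y [wy y1]] : exists y, w <= y /\ 1 - @Phi R y < e / w.
    near (pinfty_nbhs R) => y; exists y; split.
      by near: y; by apply: nbhs_pinfty_ge; rewrite num_real.
    by near: y; exact: Phi_pinfty.
  have [c /andP[wc cy]] := MVT_global wy dg.
  rewrite ltr_pdivlMr // in y1.
  have : 0 < phi y := phi_gt0 y.
  have : (w - c) * phi c * (y - w) <= 0.
    have := phi_gt0 c => h; rewrite mulr_le0_ge0 ?subr_ge0 //.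
    by rewrite mulr_le0_ge0 ?subr_le0 // ltW.
  rewrite /g; lra.
by apply/ler_addgt0Pr.
Unshelve. all: by end_near.
Qed.

Lemma pdf_inv_gt0 x : 0 < pdf_inv x.
Proof. by rewrite -(pmulr_rgt0 _ (phi_gt0 x)) phi_pdf_inv. Qed.

Lemma pdf_inv_opp x : pdf_inv (- x) = pdf_inv x.
Proof. by rewrite /pdf_inv sqrrN. Qed.

Definition mills_ratio w : R := (1 - @Phi R w) * pdf_inv w.

Lemma mills_ratio_ge0 w : 0 <= mills_ratio w.
Proof. by rewrite mulr_ge0 ?(ltW (pdf_inv_gt0 w)) // subr_ge0 Phi_le1. Qed.

Lemma mul_mills_ratio_le1 w : 0 <= w -> w * mills_ratio w <= 1.
Proof.
rewrite le_eqVlt => /orP[/eqP<-|w0]; first by rewrite mul0r ler01.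
by rewrite -(phi_pdf_inv w) /mills_ratio mulrA ler_pM2r ?pdf_inv_gt0 // mills.
Qed.

Definition mills_bound : R := 1 + pdf_inv 1.

(** Up to [1] the numerator is at most [1] and the density at least its value at
    [1]; beyond, the preceding bound applies. *)
Lemma mills_ratio_le w : 0 <= w -> mills_ratio w <= mills_bound.
Proof.
move=> w0; have [w1|w1] := leP w 1.
  have : pdf_inv w <= pdf_inv 1.
    rewrite /pdf_inv ler_wpM2l ?invr_ge0 ?normal_peak_ge0 // ler_expR; nra.
  rewrite /mills_bound /mills_ratio => h.
  by have := Phi_ge0 w; have := Phi_le1 w; have := pdf_inv_gt0 w; nra.
have := mul_mills_ratio_le1 w0; have := mills_ratio_ge0 w; have := pdf_inv_gt0 1.
by rewrite /mills_bound; nra.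
Qed.

Lemma is_derive_mills_ratio w : is_derive w 1 mills_ratio (w * mills_ratio w - 1).
Proof.
have d1 := is_deriveB (is_derive_cst (1 : R) w 1) (is_derive_Phi w).
apply: (is_derive_eq (is_deriveM d1 (is_derive_pdf_inv w))).
rewrite /GRing.scale /mills_ratio /= -[(cst 1 - _) w]/(1 - @Phi R w).
by rewrite -[X in _ = _ - X](phi_pdf_inv w); ring.
Qed.

(** The bounded solution [f] of Stein's equation
    [f'(w) - w * f(w) = (w <= z) - Phi z]. The usual left branch
    [(1 - Phi z) * Phi w / phi w] is written with [- w], so that the reflection
    [(z, w) -> (- z, - w)] exchanges the branches. *)
Definition stein_sol z w :=
  if w <= z then (1 - @Phi R z) * mills_ratio (- w) else @Phi R z * mills_ratio w.

(** For [w < 0], [Phi z <= Phi w] turns the product into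
    [mills_ratio (- w) * (1 - Phi (- w))] at most, so bounds on the positive
    half-line suffice. *)
Lemma right_branch_bounds z w : z <= w ->
  @Phi R z * mills_ratio w <= mills_bound /\ `|w * (@Phi R z * mills_ratio w)| <= 1.
Proof.
move=> zw; have P0 := Phi_ge0 z; have P1 := Phi_le1 z; have v0 := mills_ratio_ge0 w.
have [w0|w0] := leP 0 w.
  have vK := mills_ratio_le w0; have wv := mul_mills_ratio_le1 w0; split; first by nra.
  rewrite ger0_norm; last by do ![apply: mulr_ge0 => //].
  by rewrite mulrCA; have := mulr_ge0 w0 v0; nra.
have w0' : 0 <= - w by lra.
have le : @Phi R z * mills_ratio w <= mills_ratio (- w).
  rewrite /mills_ratio pdf_inv_opp Phi_opp mulrA ler_wpM2r ?(ltW (pdf_inv_gt0 _)) //.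
  by have := ndecr_Phi zw; have := Phi_ge0 w; have := Phi_le1 w; nra.
have vK := mills_ratio_le w0'; have wv := mul_mills_ratio_le1 w0'.
split; first exact: (le_trans le vK).
have pv0 : 0 <= @Phi R z * mills_ratio w by exact: mulr_ge0.
rewrite normrM (ltr0_norm w0) (ger0_norm pv0); apply: (le_trans _ wv).
by rewrite ler_wpM2l.
Qed.

Lemma stein_sol_bounds z w :
  0 <= stein_sol z w <= mills_bound /\ `|w * stein_sol z w| <= 1.
Proof.
rewrite /stein_sol; case: (leP w z) => wz.
  have zw : - z <= - w by rewrite lerN2.
  have [] := right_branch_bounds zw; rewrite Phi_opp => h1 h2.
  by rewrite h1 mulr_ge0 ?mills_ratio_ge0 ?subr_ge0 ?Phi_le1 //; rewrite mulNr normrN in h2.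
have [h1 h2] := right_branch_bounds (ltW wz).
by rewrite h1 h2 mulr_ge0 ?mills_ratio_ge0 ?Phi_ge0.
Qed.

(** The mean value theorem writes the difference quotient as [x * g x + k] at an
    intermediate point; applied again to [x * g x + k], whose derivative
    [g x + x * (x * g x + k)] grows at most linearly, it compares this with the
    value at the end point [c]. *)
Lemma smooth_bound (g : R -> R) k M a b c :
  (forall x, is_derive x 1 g (x * g x + k)) -> 0 <= M -> a < b -> b - a <= 1 ->
  (forall x, a <= x <= b -> `|g x| <= M /\ `|x * g x + k| <= 2) ->
  (c == a) || (c == b) ->
  `|c * g c + k - (g b - g a) / (b - a)| <= (M + 4) * ((b - a) * (1 + c ^+ 2)).
Proof.
move=> dg M0 ab ab1 bd cab.
have [y /andP[ay yb] ->] := MVT_global (ltW ab) dg.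
have ba0 : b - a != 0 by rewrite subr_eq0 gt_eqF.
rewrite mulfK //.
have cab' : a <= c <= b by case/orP: cab => /eqP->; rewrite lexx ltW.
pose h x := x * g x + k; rewrite -/(h c) -/(h y).
pose dh x := g x + x * h x.
have dhP x : is_derive x 1 h (dh x).
  have d1 := is_deriveM (is_derive_id x 1) (dg x).
  apply: (is_derive_eq (is_deriveD d1 (is_derive_cst k x 1))).
  by rewrite /GRing.scale /dh /h /=; ring.
have key x1 x2 : a <= x1 -> x1 <= x2 -> x2 <= b -> c - 1 <= x1 -> x2 <= c + 1 ->
    `|h x2 - h x1| <= (M + 4) * ((b - a) * (1 + c ^+ 2)).
  move=> l1 l2 l3 l4 l5; have [t /andP[t1 t2] ->] := MVT_global l2 dhP.
  have tab : a <= t <= b by lra.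
  have [gM h2] := bd t tab.
  have tc : `|t| <= 1 + `|c|.
    have -> : t = (t - c) + c by ring.
    by apply: (le_trans (ler_normD _ _)); rewrite lerD2r ler_norml; lra.
  have dt : `|dh t| <= (M + 4) * (1 + c ^+ 2).
    apply: (le_trans (ler_normD _ _)); rewrite normrM -/(h t).
    have t2' : `|t| * `|h t| <= (1 + `|c|) * 2 by apply: ler_pM.
    have c2 : 2 * `|c| <= 1 + c ^+ 2.
      have : 0 <= (1 - `|c|) ^+ 2 by rewrite sqr_ge0.
      by rewrite sqrrB expr1n mul1r -[c ^+ 2]real_normK ?num_real //; lra.
    have := sqr_ge0 c; nra.
  rewrite normrM [X in _ <= X](_ : _ = (M + 4) * (1 + c ^+ 2) * (b - a)); last by ring.
  apply: ler_pM => //; rewrite ger0_norm; lra.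
case/orP: cab => /eqP e.
  by rewrite distrC; apply: key; lra.
by apply: key; lra.
Qed.

(** The derivative of [stein_sol z], with its left value at the jump [w = z]. *)
Definition stein_deriv z w := w * stein_sol z w + (w <= z)%R%:R - @Phi R z.

Lemma stein_deriv_bound z w : `|stein_deriv z w| <= 2.
Proof.
have [_] := stein_sol_bounds z w; rewrite /stein_deriv !ler_norml.
by have := Phi_ge0 z; have := Phi_le1 z; case: (w <= z) => /=; lra.
Qed.

Lemma is_derive_left_branch z w : is_derive w 1 (fun w => (1 - @Phi R z) * mills_ratio (- w))
  (w * ((1 - @Phi R z) * mills_ratio (- w)) + (1 - @Phi R z)).
Proof.
have dN := is_derive1_comp (is_derive_mills_ratio (- w)) (is_deriveNid w 1).
apply: (is_derive_eq (is_deriveZ (1 - @Phi R z) dN)).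
by rewrite /GRing.scale /=; ring.
Qed.

Lemma is_derive_right_branch z w : is_derive w 1 (fun w => @Phi R z * mills_ratio w)
  (w * (@Phi R z * mills_ratio w) + - @Phi R z).
Proof.
apply: (is_derive_eq (is_deriveZ (@Phi R z) (is_derive_mills_ratio w))).
by rewrite /GRing.scale /=; ring.
Qed.

Lemma stein_sol_left z w : w <= z -> stein_sol z w = (1 - @Phi R z) * mills_ratio (- w).
Proof. by rewrite /stein_sol => ->. Qed.

Lemma stein_sol_right z w : z <= w -> stein_sol z w = @Phi R z * mills_ratio w.
Proof.
rewrite /stein_sol; case: (leP w z) => // wz zw.
have -> : w = z by apply/eqP; rewrite eq_le wz.
by rewrite /mills_ratio pdf_inv_opp Phi_opp; ring.
Qed.

Lemma stein_deriv_left z w : w <= z ->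
  stein_deriv z w = w * ((1 - @Phi R z) * mills_ratio (- w)) + (1 - @Phi R z).
Proof. by move=> wz; rewrite /stein_deriv stein_sol_left // wz /=; ring. Qed.

Lemma stein_deriv_right z w : z < w ->
  stein_deriv z w = w * (@Phi R z * mills_ratio w) + - @Phi R z.
Proof. by move=> wz; rewrite /stein_deriv (stein_sol_right (ltW wz)) leNgt wz addr0. Qed.

Lemma stein_sol_lipschitz z a b : a <= b ->
  `|stein_sol z b - stein_sol z a| <= 3 * (b - a).
Proof.
have L a' b' : a' <= b' -> b' <= z -> `|stein_sol z b' - stein_sol z a'| <= 3 * (b' - a').
  move=> ab bz; rewrite !stein_sol_left ?(le_trans ab) //.
  have [c /andP[ac cb] ->] := MVT_global ab (is_derive_left_branch z).
  rewrite -stein_deriv_left ?(le_trans cb) // normrM [X in _ * X]ger0_norm ?subr_ge0 //.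
  by rewrite ler_wpM2r ?subr_ge0 //; have := stein_deriv_bound z c; lra.
have Rt a' b' : z <= a' -> a' <= b' -> `|stein_sol z b' - stein_sol z a'| <= 3 * (b' - a').
  move=> az ab; rewrite !stein_sol_right ?(le_trans az) //.
  have [c /andP[ac cb] ->] := MVT_global ab (is_derive_right_branch z).
  have zc := le_trans az ac.
  rewrite normrM [X in _ * X]ger0_norm ?subr_ge0 //.
  rewrite ler_wpM2r ?subr_ge0 // -stein_sol_right //.
  have [_] := stein_sol_bounds z c; rewrite !ler_norml.
  by have := Phi_ge0 z; have := Phi_le1 z; lra.
move=> ab; have [bz|zb] := leP b z; first exact: L.
have [za|az] := leP z a; first exact: Rt.
have h1 := L _ _ (ltW az) (lexx z); have h2 := Rt _ _ (lexx z) (ltW zb).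
have -> : stein_sol z b - stein_sol z a =
   (stein_sol z b - stein_sol z z) + (stein_sol z z - stein_sol z a) by ring.
by apply: (le_trans (ler_normD _ _)); lra.
Qed.

(** On a step that avoids [z] one smooth branch is in force and [smooth_bound]
    applies; a step across [z] has both ends within [d] of it, and there the
    Lipschitz bound suffices. *)
Lemma stein_sol_diff z d x c : 0 < d -> d <= 1 -> (c == x) || (c == x + d) ->
  `|stein_deriv z c - (stein_sol z (x + d) - stein_sol z x) / d| <=
  (mills_bound + 5) * (d * (1 + c ^+ 2) + (`|c - z| <= d)%R%:R).
Proof.
move=> d0 d1 cx.
have K0 : 0 <= mills_bound by rewrite /mills_bound; have := pdf_inv_gt0 1; lra.
have xd : x < x + d by rewrite ltrDl.
have dE : x + d - x = d by ring.
have d2 : x + d - x <= 1 by rewrite dE.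
have cab : x <= c <= x + d by case/orP: cx => /eqP->; lra.
have u0 : 0 <= d * (1 + c ^+ 2) by rewrite mulr_ge0 ?addr_ge0 ?sqr_ge0 // ltW.
have fin (t : R) : t <= (mills_bound + 4) * (d * (1 + c ^+ 2)) ->
    t <= (mills_bound + 5) * (d * (1 + c ^+ 2) + (`|c - z| <= d)%R%:R).
  by case: (`|c - z| <= d)%R => /= h; nra.
have [xz|zx] := leP (x + d) z.
  apply: fin; rewrite !stein_sol_left ?(le_trans (ltW xd)) //.
  rewrite stein_deriv_left; last by lra.
  have := smooth_bound (is_derive_left_branch z) K0 xd d2 _ cx.
  rewrite dE; apply => t /andP[xt tx]; have tz := le_trans tx xz.
  rewrite -stein_deriv_left // -stein_sol_left //.
  by have [/andP[h0 h1] _] := stein_sol_bounds z t; rewrite ger0_norm // stein_deriv_bound.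
have [xz|xz] := ltP z x.
  have zx' := ltW xz; have zxd : z <= x + d by lra.
  apply: fin; rewrite !stein_sol_right //.
  rewrite stein_deriv_right; last by lra.
  have := smooth_bound (is_derive_right_branch z) K0 xd d2 _ cx.
  rewrite dE; apply => t /andP[xt tx]; have tz := lt_le_trans xz xt.
  rewrite -stein_deriv_right // -(stein_sol_right (ltW tz)).
  by have [/andP[h0 h1] _] := stein_sol_bounds z t; rewrite ger0_norm // stein_deriv_bound.
have -> : (`|c - z| <= d)%R by rewrite ler_norml; lra.
apply: (le_trans (ler_normB _ _)).
have : `|(stein_sol z (x + d) - stein_sol z x) / d| <= 3.
  rewrite normrM normfV (gtr0_norm d0) ler_pdivrMr //.
  by have := stein_sol_lipschitz z (ltW xd); rewrite dE.
have := stein_deriv_bound z c; rewrite /=; nra.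
Qed.

End Gauss.

(** * The Berry-Esseen bound *)

Section IsolatedVertices.
Variable R : realType.

Lemma wsum_sumXn (I : finType) (A : {set I}) (k : I -> nat) (g : nat -> R) :
  wsum (\sum_(i in A) 'X^(k i)) g = \sum_(i in A) g (k i).
Proof.
rewrite (big_morph (fun p : {poly R} => wsum p g) (fun p q => wsumD p q g) (_ : _ = 0)).
  by apply: eq_bigr => i _; rewrite (@wsumE _ (k i).+1) ?size_polyXn // big_ord_recr /=
    coefXn eqxx mul1r big1 ?add0r // => j _; rewrite coefXn ltn_eqF ?mul0r.
by rewrite /wsum size_poly0 big_ord0.
Qed.

Lemma ER_expect_isolated n m (g : nat -> R) :
  ER_expect m (fun G : graph n => g (nb_isolated G)) =
  #|ER_support n m|%:R^-1 * wsum (isolated_poly R n m) g.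
Proof.
rewrite wsum_sumXn /ER_expect mulr_sumr [RHS]big_mkcond /=.
by apply: eq_bigr => G _; rewrite /ER; case: ifP => _; rewrite ?mul0r.
Qed.

(** The counting polynomial has only real zeros, being a translate of
    [moment_poly]; so it is the generating polynomial of a sum of independent
    Bernoulli variables, to which Stein's identity applies. *)
Lemma isolated_law n m : (m <= 'C(n, 2))%N ->
  exists p A B mu v, stein_dec p A B mu v /\
    forall g : nat -> R, ER_expect m (fun G : graph n => g (nb_isolated G)) = wsum p g.
Proof.
move=> mn.
have N1 : (isolated_poly R n m).[1] = #|ER_support n m|%:R.
  rewrite /isolated_poly horner_sum -sum1_card natr_sum; apply: eq_bigr => G _.
  by rewrite hornerXn expr1n.
have N0 : #|ER_support n m|%:R != 0 :> R.
  by rewrite -N1 isolated_polyE horner_comp !hornerE subrr horner_coef0 moment_poly_neq0.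
have st : real_stable (isolated_poly R n m).
  by rewrite isolated_polyE; apply: real_stable_comp_XsubC; exact: real_stable_moment_poly.
have nn : nonneg_coefs (isolated_poly R n m).
  by move=> k; rewrite /isolated_poly coef_sum sumr_ge0 // => G _; rewrite coefXn ler0n.
have [s s01 Es] := real_stable_bernoulli nn st.
have [A [B [mu' [v dec]]]] := bernoulli_stein_dec s01.
exists (\prod_(a <- s) bernoulli_poly a), A, B, mu', v; split=> // g.
by rewrite ER_expect_isolated Es wsumZ N1 mulKf.
Qed.

Lemma ER_prob_expect n m (A : pred (graph n)) :
  ER_prob R m A = ER_expect m (fun G => (A G)%:R).
Proof.
rewrite /ER_prob /ER_expect [LHS]big_mkcond /=.
by apply: eq_bigr => G _; case: (A G); rewrite ?mulr1 ?mulr0.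
Qed.

(** With [f] the solution of Stein's equation at [z], the mean of [f'(W) - W f(W)]
    is the difference of the distribution functions at [z]. *)
Theorem isolated_berry_esseen : exists2 C : R, 1 <= C &
  forall n m, (m <= 'C(n, 2))%N -> 0 < sigma R n m ->
  sigma R n m ^+ 2 <= mu R n m /\
  forall z, `|ER_prob R m (fun G : graph n => W R m G <= z) - Phi z| <= C / sigma R n m.
Proof.
pose K : R := mills_bound R.
have K1 : 1 <= K by rewrite lerDl ltW // pdf_inv_gt0.
exists (4 * (K + 5)) => [|n m mn s0]; first by lra.
have [p [A [B [mu' [v [dec law]]]]]] := isolated_law mn.
have Emu : mu R n m = mu'.
  by rewrite /mu (law (fun k => k%:R)) (mean_wsum dec).
have Ev : ER_variance m (@Y R n) = v.
  rewrite /ER_variance -/(mu R n m) Emu (law (fun k => (k%:R - mu') ^+ 2)).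
  exact: variance_wsum dec.
have v0 : 0 < v by move: s0; rewrite /sigma Ev sqrtr_gt0.
have s2 : sigma R n m ^+ 2 = v by rewrite /sigma Ev sqr_sqrtr // ltW.
split; first by rewrite s2 Emu (sd_le dec).
move=> z; set s := sigma R n m in s0 s2 *; pose d := s^-1.
have d0 : 0 < d by rewrite invr_gt0.
have d2 : d ^+ 2 * v = 1 by rewrite -s2 /d -exprMn mulVf ?expr1n // gt_eqF.
have EP : ER_prob R m (fun G : graph n => W R m G <= z) =
    wsum p (fun k => ((k%:R - mu') * d <= z)%R%:R).
  by rewrite ER_prob_expect -law /W -/s s0 Emu.
rewrite EP.
(* For [s < 1] the bound exceeds [1]; otherwise [d <= 1], as [stein_sol_diff]
   requires. *)
have [sle1|s1] := ltP s 1.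
  have i0 k : 0 <= ((k%:R - mu') * d <= z)%R%:R :> R by rewrite ler0n.
  have p0 : 0 <= wsum p (fun k => ((k%:R - mu') * d <= z)%R%:R).
    by apply: sumr_ge0 => k _; rewrite mulr_ge0 // (sd_p dec).
  have p1 : wsum p (fun k => ((k%:R - mu') * d <= z)%R%:R) <= 1.
    rewrite -[leRHS](sd_1 dec) -wsum1; apply: le_wsum (sd_p dec) _ => k.
    by rewrite /= lern1 leq_b1.
  apply: (@le_trans _ _ 1).
    by rewrite ler_norml; have := Phi_ge0 z; have := Phi_le1 z; lra.
  by rewrite ler_pdivlMr //; lra.
have d1 : d <= 1 by rewrite invf_le1.
have := stein_bound dec d0 d2 (f := @stein_sol R z) (h := @stein_deriv R z)
  (z := z) (K := K + 5).
rewrite (@eq_wsum _ p _ (fun k => ((k%:R - mu') * d <= z)%R%:R - @Phi R z * 1)); last first.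
  by move=> k; rewrite /stein_deriv; ring.
rewrite wsumBr wsumZr wsum1 (sd_1 dec) mulr1; apply; last by lra.
by move=> x c xc; apply: stein_sol_diff.
Qed.

End IsolatedVertices.

(* Extended-real division: (0%:E)^-1 = +oo, so the bound is +oo when r = 0. *)
Theorem theorem1p3 (R : realType) :
  exists C : R, 0 < C /\
    forall n m : nat, Theta n m ->
      (ereal_sup (range (fun z : R =>
          `|@ER_prob R n m (fun G => (@W R n m G <= z)%R) - Phi z|%R%:E))
        <= C%:E / (r R n m)%:E)%E.
Proof.
have [C C1 HC] := isolated_berry_esseen R.
have C0 : 0 < C by lra.
exists C; split=> // n m /andP[n3 /andP[m0 mn]].
rewrite /r; case: ifPn => [_|s0].
  by rewrite inve0 gt0_muley ?lte_fin // leey.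
have sg : 0 < sigma R n m by rewrite lt_def s0 sqrtr_ge0.
have [s2 H] := HC n m (ltnW mn) sg.
set s := sigma R n m in sg s2 H *; set D := mu R n m * _.
have q0 : 0 <= m%:R ^+ 2 / n%:R ^+ 2 :> R by rewrite divr_ge0.
have s20 : 0 < s ^+ 2 by rewrite exprn_gt0.
have sD : s ^+ 2 <= D by rewrite /D; nra.
have D0 : 0 < D by lra.
have r0 : 0 < s ^+ 3 / D by rewrite divr_gt0 // exprn_gt0.
have rs : s ^+ 3 / D <= s.
  by rewrite ler_pdivrMr // exprS ler_pM2l.
apply: ge_ereal_sup => _ [z _ <-].
rewrite inver gt_eqF // -EFinM lee_fin.
apply: (le_trans (H z)); rewrite ler_pM2l // lef_pV2 //.
Qed.
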